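(* Every weakly singular $\widetilde{\mathbb{C}}$-linear map from an s-$\widetilde{\mathbb{C}}$-module $(\mathcal{G},\tau_1)$ onto a barrelled topological $\widetilde{\mathbb{C}}$-module $(\mathcal{F},\tau_2)$ is open.
   Context: ''Coarser'' and ''finer'' are meant non-strictly; $\tau\prec\tau'$ means that $\tau$ is coarser than $\tau'$. Generalized numbers: $\widetilde{\mathbb{C}}=\mathcal{E}_M/\mathcal{N}$, where $\mathcal{E}_M$ is the ring of nets $(c_\varepsilon)_\varepsilon\in\mathbb{C}^{(0,1]}$ with $|c_\varepsilon|=O(\varepsilon^{-N})$ as $\varepsilon\to0$ for some $N\in\mathbb{N}$, and $\mathcal{N}$ is the ideal of nets with $|c_\varepsilon|=O(\varepsilon^{q})$ for all $q\in\mathbb{N}$; $[(c_\varepsilon)_\varepsilon]$ denotes the class of $(c_\varepsilon)_\varepsilon$. The valuation is $\mathrm{v}(c)=\sup\{b\in\mathbb{R}: |c_\varepsilon|=O(\varepsilon^b)\text{ as }\varepsilon\to0\}$ and $|c|_{\mathrm e}=e^{-\mathrm{v}(c)}$; $\widetilde{\mathbb{C}}$ carries the topology of the ultrametric $|c-d|_{\mathrm e}$. A topological $\widetilde{\mathbb{C}}$-module is a $\widetilde{\mathbb{C}}$-module with a $\widetilde{\mathbb{C}}$-linear topology, i.e. one making addition and scalar multiplication $\widetilde{\mathbb{C}}\times\mathcal{G}\to\mathcal{G}$ continuous. A subset $A$ of a $\widetilde{\mathbb{C}}$-module $\mathcal{G}$ is balanced if $\lambda A\subseteq A$ whenever $|\lambda|_{\mathrm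 e}\le1$; absorbent if for every $u\in\mathcal{G}$ there is $a\in\mathbb{R}$ with $u\in[(\varepsilon^b)_\varepsilon]A$ for all $b\le a$. A string in $\mathcal{G}$ is a sequence $(U_n)_{n\ge1}$ of balanced and absorbent subsets of $\mathcal{G}$ (its knots) with $U_{n+1}+U_{n+1}\subseteq U_n$ for all $n$ and $[(\varepsilon^{-n})_\varepsilon]U_{n+p}\subseteq U_p$ for all $n,p\ge1$. In a topological $\widetilde{\mathbb{C}}$-module a string is closed if every knot is closed, and topological if every knot is a neighborhood of $0$. A topological $\widetilde{\mathbb{C}}$-module (or its topology) is barrelled if every closed string in it is topological. For a $\widetilde{\mathbb{C}}$-linear topology $\tau$ on a $\widetilde{\mathbb{C}}$-module, the associated barrelled topology $\tau^t$ is the coarsest barrelled $\widetilde{\mathbb{C}}$-linear topology finer than $\tau$ (it exists). A Hausdorff topological $\widetilde{\mathbb{C}}$-module $(\mathcal{H},\tau_0)$ is an infra-s $\widetilde{\mathbb{C}}$-module if for every Hausdorff $\widetilde{\mathbb{C}}$-linear topology $\tau$ on $\mathcal{H}$ coarser than $\tau_0$ one has $\tau_0\prec\tau^t$. A Hausdorff topological $\widetilde{\mathbb{C}}$-module $(\mathcal{G},\tau)$ is an s-$\widetilde{\mathbb{C}}$-module if for every closed $\widetilde{\mathbb{C}}$-submodule $M$ the quotient $\mathcal{G}/M$ with the quotient topology is an infra-s $\widetilde{\mathbb{C}}$-module. A $\widetilde{\mathbb{C}}$-linear map $T:\mathcal{G}\to\mathcal{F}$ between topological $\widetilde{\mathbb{C}}$-modules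 (not assumed continuous) is weakly singular if $\bigcap_{V}\overline{T^{-1}(V)}=\overline{\mathrm{Ker}(T)}$, the intersection being over all neighborhoods $V$ of $0$ in $\mathcal{F}$ and closures being taken in $\mathcal{G}$. *)

(* Defs.v *)
From HB Require Import structures.
From mathcomp Require Import all_boot all_order all_algebra.
From mathcomp Require Import complex.
From mathcomp Require Import all_classical all_reals all_analysis.

Set Implicit Arguments.
Unset Strict Implicit.
Unset Printing Implicit Defensive.

Import Order.TTheory GRing.Theory Num.Theory.
Import ComplexField.Normc.

Local Open Scope classical_set_scope.
Local Open Scope ring_scope.

Definition unit_itv (R : realType) : Type := {e : R | 0 < e <= 1}.

HB.instance Definition _ (R : realType) := Choice.on (unit_itv R).

Lemma one_in_unit_itv (R : realType) : 0 < (1 : R) <= 1.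
Proof. by rewrite ltr01 lexx. Qed.

HB.instance Definition _ (R : realType) :=
  isPointed.Build (unit_itv R) (exist _ 1 (one_in_unit_itv R)).

Notation net R := (unit_itv R -> R[i]).

(* |c_e| = O(e ^ b) as e -> 0 *)
Definition bigO_pow (R : realType) (c : net R) (b : R) : Prop :=
  exists K eta : R, 0 < eta /\
    forall e : unit_itv R, sval e < eta -> normc (c e) <= K * sval e `^ b.

Section BigOPow.
Context {R : realType}.
Implicit Types (c d : net R) (a b : R).

Lemma bigO_powW c a b : a <= b -> bigO_pow c b -> bigO_pow c a.
Proof.
move=> ab [K [eta [eta0 H]]]; exists `|K|, eta; split=> // e /H {}H.
apply: le_trans H _; have e01 := svalP e.
apply: (@le_trans _ _ (`|K| * sval e `^ b)).
  by rewrite ler_wpM2r ?powR_ge0 ?ler_norm.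
by rewrite ler_wpM2l // ger_powR.
Qed.

Lemma bigO_powD c d b : bigO_pow c b -> bigO_pow d b -> bigO_pow (c + d) b.
Proof.
move=> [K [eta [eta0 H]]] [L [xi [xi0 G]]].
exists (K + L), (Num.min eta xi); split; first by rewrite lt_min eta0.
move=> e; rewrite lt_min => /andP[/H {}H /G {}G].
by rewrite mulrDl; apply: le_trans (le_normcD _ _) _; rewrite lerD.
Qed.

Lemma bigO_powN c b : bigO_pow c b -> bigO_pow (- c) b.
Proof.
move=> [K [eta [eta0 H]]]; exists K, eta; split=> // e /H.
by rewrite -[normc (c e)]normcN.
Qed.

Lemma bigO_powM c d a b :
  bigO_pow c a -> bigO_pow d b -> bigO_pow (c * d) (a + b).
Proof.
move=> [K [eta [eta0 H]]] [L [xi [xi0 G]]].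
exists (K * L), (Num.min eta xi); split; first by rewrite lt_min eta0.
move=> e; rewrite lt_min => /andP[/H {}H /G {}G].
have nge0 (z : R[i]) : 0 <= normc z by case: z => x y; exact: sqrtr_ge0.
have e0 : sval e != 0 by case/andP: (svalP e) => /lt0r_neq0.
rewrite powRD ?e0 ?implybT // mulrACA.
by rewrite [(c * d) e]/(c e * d e) normcM ler_pM.
Qed.

Lemma bigO_pow0 b : bigO_pow (0 : net R) b.
Proof.
exists 0, 1; split=> // e _; rewrite mul0r.
by rewrite [(0 : net R) e]/(0 : R[i]) normc0.
Qed.

Lemma bigO_pow_powR b : bigO_pow (fun e : unit_itv R => (sval e `^ b)%:C%C) b.
Proof.
exists 1, 1; split=> // e _; rewrite mul1r /normc /= expr0n /= addr0.
by rewrite sqrtr_sqr ger0_norm ?powR_ge0.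
Qed.

Lemma bigO_pow1 : bigO_pow (1 : net R) 0.
Proof.
exists 1, 1; split=> // e _; rewrite powRr0 mulr1.
by rewrite [(1 : net R) e]/(1 : R[i]) normc1.
Qed.

End BigOPow.

Definition moderate (R : realType) : {pred net R} :=
  [pred c : net R | `[< exists N : nat, bigO_pow c (- N%:R) >]].

Lemma moderateP (R : realType) (c : net R) :
  reflect (exists b : R, bigO_pow c b) (c \in @moderate R).
Proof.
apply: (iffP (asboolP _)) => [[N cN]|[b cb]]; first by exists (- N%:R).
exists (Num.bound `|b|); apply: bigO_powW cb.
have := archi_boundP (normr_ge0 b); rewrite lerNl => /ltW; apply: le_trans.
by rewrite -normrN ler_norm.
Qed.

Lemma moderate_subring_closed (R : realType) : subring_closed (@moderate R).
Proof.
split=> [|c d /moderateP[a ca] /moderateP[b db]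
         |c d /moderateP[a ca] /moderateP[b db]]; apply/moderateP.
- by exists 0; exact: bigO_pow1.
- exists (Num.min a b); apply: bigO_powD; last apply: bigO_powN.
    by apply: bigO_powW ca; rewrite ge_min lexx.
  by apply: bigO_powW db; rewrite ge_min lexx orbT.
- by exists (a + b); exact: bigO_powM.
Qed.

HB.instance Definition _ (R : realType) :=
  GRing.isSubringClosed.Build (net R) (@moderate R)
    (@moderate_subring_closed R).

Record EM (R : realType) := MkEM { EM_net :> net R; _ : EM_net \in @moderate R }.

HB.instance Definition _ (R : realType) := [isSub for @EM_net R].
HB.instance Definition _ (R : realType) := [Choice of EM R by <:].
HB.instance Definition _ (R : realType) :=
  [SubChoice_isSubComNzRing of EM R by <:].

Definition negligible_net (R : realType) : {pred EM R} :=
  [pred c : EM R | `[< forall q : nat, bigO_pow c q%:R >]].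

Lemma negligible_netP (R : realType) (c : EM R) :
  reflect (forall b : R, bigO_pow c b) (c \in @negligible_net R).
Proof.
apply: (iffP (asboolP _)) => [cN b|cN q]; last exact: cN.
apply: bigO_powW (cN (Num.bound `|b|)).
by apply: le_trans (ltW (archi_boundP (normr_ge0 b))); exact: ler_norm.
Qed.

Lemma negligible_idealr_closed (R : realType) :
  idealr_closed (@negligible_net R).
Proof.
split.
- by apply/negligible_netP => b; rewrite [EM_net 0](raddf0 (val : EM R -> net R)); exact: bigO_pow0.
- apply/negP => /negligible_netP /(_ 1) [K [eta [eta0 H]]].
  pose m := Num.min (eta / 2) (Num.min 1 ((`|K| + 1)^-1 / 2)).
  have K0 : 0 < `|K| + 1 by rewrite ltr_wpDl.
  have m0 : 0 < m by rewrite /m !lt_min !divr_gt0 ?invr_gt0 ?ltr0n //= ltr01.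
  have m1 : 0 < m <= 1 by rewrite m0 /m !ge_min lexx orbT.
  have meta : m < eta.
    by rewrite /m gt_min ltr_pdivrMr // mulr_natr mulr2n ltrDl eta0.
  have := H (exist _ m m1) meta.
  rewrite [X in normc X](_ : _ = 1) ?normc1; last first.
    by rewrite [EM_net 1](rmorph1 (val : EM R -> net R)).
  rewrite /= powRr1 ?(ltW m0) // => /(le_trans _) -/(_ 1 (lexx _)).
  apply/negP; rewrite -ltNge.
  apply: (@le_lt_trans _ _ ((`|K| + 1) * m)).
    by rewrite ler_wpM2r ?(ltW m0) // (le_trans (ler_norm _)) // lerDl ler01.
  apply: (@le_lt_trans _ _ ((`|K| + 1) * ((`|K| + 1)^-1 / 2))).
    by rewrite ler_wpM2l ?(ltW K0) // /m !ge_min lexx !orbT.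
  by rewrite mulrA mulfV ?gt_eqF // mul1r invf_lt1 // ltr1n.
- move=> a u v /negligible_netP uN /negligible_netP vN.
  apply/negligible_netP => b /=.
  have /moderateP[N aN] : EM_net a \in @moderate R by case: a.
  apply: bigO_powD => //.
  by rewrite -[b](subrKC N); exact: bigO_powM.
Qed.

HB.instance Definition _ (R : realType) :=
  isIdealr.Build (EM R) (@negligible_net R) (@negligible_idealr_closed R).

Definition Ctilde (R : realType) : Type := {ideal_quot (@negligible_net R)}.

HB.instance Definition _ (R : realType) := GRing.ComNzRing.on (Ctilde R).
HB.instance Definition _ (R : realType) : NzRingQuotient (EM R)
    (Quotient.equiv (@negligible_net R)) 0 -%R +%R 1 *%R (Ctilde R) :=
  NzRingQuotient.on (Ctilde R).

Lemma powR_moderate (R : realType) (b : R) :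
  (fun e : unit_itv R => (sval e `^ b)%:C%C) \in @moderate R.
Proof. by apply/moderateP; exists b; exact: bigO_pow_powR. Qed.

Definition eps_pow (R : realType) (b : R) : Ctilde R :=
  (\pi_(Ctilde R) (MkEM (powR_moderate b)))%qT.

(* valuation_pi: the value does not depend on the representative *)
Definition valuation (R : realType) (c : Ctilde R) : \bar R :=
  ereal_sup [set b%:E | b in bigO_pow (repr c)].

(* norm_eE: fine discards no information here *)
Definition norm_e (R : realType) (c : Ctilde R) : R :=
  fine (expeR (- valuation c)).

Section SharpNorm.
Context {R : realType}.
Implicit Types (c d : Ctilde R).

Lemma valuation_pi (x : EM R) :
  valuation (\pi_(Ctilde R) x)%qT = ereal_sup [set b%:E | b in bigO_pow x].
Proof.
rewrite /valuation; set y := repr _.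
have yx : (y - x) \in @negligible_net R.
  by rewrite Quotient.idealrBE reprK.
have xyb := negligible_netP _ yx.
congr (ereal_sup (_ @` _)); apply/seteqP; split => b Hb; rewrite /mkset.
  rewrite (_ : EM_net x = EM_net y + - EM_net (y - x)).
    by apply: bigO_powD Hb _; exact: bigO_powN.
  by rewrite [EM_net (y - x)](raddfB (val : EM R -> net R)) opprB subrKC.
rewrite (_ : EM_net y = EM_net x + EM_net (y - x)); first exact: bigO_powD.
by rewrite [EM_net (y - x)](raddfB (val : EM R -> net R)) subrKC.
Qed.

Lemma valuation_gtNy c : (-oo < valuation c)%E.
Proof.
have /moderateP[b cb] : EM_net (repr c) \in @moderate R by case: (repr c).
by apply: (lt_le_trans (ltNyr b)); apply: ereal_sup_ubound; exists b.
Qed.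

Lemma norm_eE c : (norm_e c)%:E = expeR (- valuation c).
Proof.
rewrite /norm_e fineK // ge0_fin_numE ?expeR_ge0 //.
have := valuation_gtNy c.
by case: (valuation c) => [r| |] //= _; rewrite ltry.
Qed.

Lemma valuation0 : valuation (0 : Ctilde R) = +oo%E.
Proof.
rewrite -(raddf0 \pi_(Ctilde R)%qT) valuation_pi.
apply/eqyP => b _; apply: ereal_sup_ubound; exists b => //.
by rewrite /mkset [EM_net 0](raddf0 (val : EM R -> net R)); exact: bigO_pow0.
Qed.

Lemma valuationN c : valuation (- c) = valuation c.
Proof.
rewrite -[c]reprK -(raddfN \pi_(Ctilde R)%qT) !valuation_pi.
congr (ereal_sup (_ @` _)); apply/seteqP.
rewrite [EM_net (- _)](raddfN (val : EM R -> net R)).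
by split => b /= /bigO_powN; rewrite ?opprK.
Qed.

Lemma valuationD c d :
  (Order.min (valuation c) (valuation d) <= valuation (c + d)%R)%E.
Proof.
rewrite leNgt lt_min; apply/negP => /andP[].
rewrite -[c]reprK -[d]reprK -(raddfD \pi_(Ctilde R)%qT) !valuation_pi.
move=> /ereal_sup_gt[_ [a ca <-] ac] /ereal_sup_gt[_ [b db <-] bd].
have : ((Order.min a b)%:E <=
    ereal_sup [set b%:E | b in bigO_pow (EM_net (repr c + repr d)%R)])%E.
  apply: ereal_sup_ubound; exists (Order.min a b) => //.
  rewrite /mkset [EM_net _](raddfD (val : EM R -> net R)).
  by apply: bigO_powD; [apply: bigO_powW ca|apply: bigO_powW db];
    rewrite ge_min lexx ?orbT.
by apply/negP; rewrite -ltNge EFin_min lt_min ac bd.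
Qed.

Lemma norm_e0 : norm_e (0 : Ctilde R) = 0.
Proof. by rewrite /norm_e valuation0. Qed.

Lemma norm_eN c : norm_e (- c) = norm_e c.
Proof. by rewrite /norm_e valuationN. Qed.

Lemma norm_eD c d : norm_e (c + d) <= Num.max (norm_e c) (norm_e d).
Proof.
rewrite -lee_fin EFin_max !norm_eE le_max !lee_expeR !leeN2.
by rewrite -ge_min valuationD.
Qed.

Lemma norm_e_ge0 c : 0 <= norm_e c.
Proof. by rewrite -lee_fin norm_eE expeR_ge0. Qed.

Definition Ctilde_ball c (r : R) : set (Ctilde R) := [set d | norm_e (c - d) < r].

Lemma Ctilde_ball_center c (r : R) : 0 < r -> Ctilde_ball c r c.
Proof. by rewrite /Ctilde_ball /mkset subrr norm_e0. Qed.

Lemma Ctilde_ball_sym c d (r : R) : Ctilde_ball c r d -> Ctilde_ball d r c.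
Proof. by rewrite /Ctilde_ball /mkset -[d - c]opprB norm_eN. Qed.

Lemma Ctilde_ball_triangle c d f (r s : R) :
  Ctilde_ball c r d -> Ctilde_ball d s f -> Ctilde_ball c (r + s) f.
Proof.
rewrite /Ctilde_ball /mkset => cd df.
rewrite -[c](subrK d) -addrA; apply: le_lt_trans (norm_eD _ _) _.
have r0 := le_lt_trans (norm_e_ge0 _) cd.
have s0 := le_lt_trans (norm_e_ge0 _) df.
by rewrite gt_max (lt_trans cd) ?ltrDl // (lt_trans df) ?ltrDr.
Qed.

HB.instance Definition _ := hasNbhs.Build (Ctilde R) (nbhs_ball_ Ctilde_ball).

Lemma Ctilde_nbhsE :
  @nbhs _ (Ctilde R) = nbhs_ (entourage_ Ctilde_ball).
Proof.
rewrite predeq2E => x A; rewrite /nbhs /= /nbhs_ball_; split.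
  move=> [e e0 xeA]; exists [set xy | Ctilde_ball xy.1 e xy.2].
    by exists e.
  by move=> y /xsectionP; exact: xeA.
move=> [E [e e0 eE] EA]; exists e => // y xy.
by apply: EA; apply/xsectionP; exact: eE.
Qed.

HB.instance Definition _ := Nbhs_isPseudoMetric.Build R (Ctilde R)
  Ctilde_nbhsE Ctilde_ball_center Ctilde_ball_sym Ctilde_ball_triangle erefl.

End SharpNorm.

(* Several topologies on one module have to be compared, so a topology on G   *)
(* is passed as an element tau of the library's class Topological G, and      *)
(* topo tau is the resulting space.                                           *)
Definition topo (T : Type) (tau : Topological T) : topologicalType :=
  Topological.Pack tau.

Definition coarser (T : Type) (tau tau' : Topological T) : Prop :=
  @open (topo tau) `<=` @open (topo tau').

Section TopologicalModules.
Context {R : realType}.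

Definition linear_topology (G : lmodType (Ctilde R)) (tau : Topological G) :
    Prop :=
  continuous ((fun p => (p.1 : G) + (p.2 : G)) :
    topo tau * topo tau -> topo tau) /\
  continuous ((fun p => p.1 *: (p.2 : G)) :
    Ctilde R * topo tau -> topo tau).

Definition balanced (G : lmodType (Ctilde R)) (A : set G) : Prop :=
  forall l : Ctilde R, norm_e l <= 1 -> [set l *: u | u in A] `<=` A.

Definition absorbent (G : lmodType (Ctilde R)) (A : set G) : Prop :=
  forall u : G, exists a : R, forall b : R, b <= a ->
    [set eps_pow b *: v | v in A] u.

(* The knots are U 1, U 2, ...; the value U 0 plays no role *)
Definition string (G : lmodType (Ctilde R)) (U : nat -> set G) : Prop :=
  [/\ forall n, (1 <= n)%N -> balanced (U n) /\ absorbent (U n),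
      forall n, (1 <= n)%N -> [set u + v | u in U n.+1 & v in U n.+1] `<=` U n &
      forall n p, (1 <= n)%N -> (1 <= p)%N ->
        [set eps_pow (- n%:R) *: u | u in U (n + p)%N] `<=` U p].

Definition closed_string (G : lmodType (Ctilde R)) (tau : Topological G)
    (U : nat -> set G) : Prop :=
  string U /\ forall n, (1 <= n)%N -> @closed (topo tau) (U n).

Definition topological_string (G : lmodType (Ctilde R)) (tau : Topological G)
    (U : nat -> set G) : Prop :=
  string U /\ forall n, (1 <= n)%N -> @nbhs _ (topo tau) (0 : G) (U n).

Definition barrelled (G : lmodType (Ctilde R)) (tau : Topological G) : Prop :=
  linear_topology tau /\
  forall U, closed_string tau U -> topological_string tau U.

(* tau^t is given by its defining property, which determines its open sets;   *)
(* infra_s accordingly speaks about any taut that has it.                     *)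
Definition associated_barrelled (G : lmodType (Ctilde R))
    (tau taut : Topological G) : Prop :=
  [/\ barrelled taut, coarser tau taut &
      forall sigma : Topological G,
        barrelled sigma -> coarser tau sigma -> coarser taut sigma].

Definition infra_s (H : lmodType (Ctilde R)) (tau0 : Topological H) : Prop :=
  [/\ linear_topology tau0, hausdorff_space (topo tau0) &
      forall tau taut : Topological H,
        linear_topology tau -> hausdorff_space (topo tau) ->
        coarser tau tau0 -> associated_barrelled tau taut -> coarser tau0 taut].

End TopologicalModules.

Section QuotientModule.
Context {K : pzRingType} {G : lmodType K}.

(* A submodule closed under + and *: is also closed under opposite; the       *)
(* library's submodClosed does not record this, but its quotients need it.    *)
Definition submod_pred (M : submodClosed G) : {pred G} := [pred x | x \in M].

Lemma submod_pred_zmod_closed (M : submodClosed G) :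
  zmod_closed (submod_pred M).
Proof. exact: GRing.submod_closedB (GRing.submodClosedP M). Qed.

HB.instance Definition _ (M : submodClosed G) :=
  GRing.isZmodClosed.Build G (submod_pred M) (submod_pred_zmod_closed M).

Definition quot_mod (M : submodClosed G) : Type :=
  Quotient.quot (submod_pred M).

HB.instance Definition _ (M : submodClosed G) := GRing.Zmodule.on (quot_mod M).
HB.instance Definition _ (M : submodClosed G) :
    ZmodQuotient G (Quotient.equiv (submod_pred M)) 0 -%R +%R (quot_mod M) :=
  ZmodQuotient.on (quot_mod M).

Variable M : submodClosed G.
Local Notation Q := (quot_mod M).

Definition quot_scale (a : K) (x : Q) : Q := (\pi_Q (a *: repr x))%qT.

Lemma pi_quot_scale a (u : G) : quot_scale a (\pi_Q u)%qT = (\pi_Q (a *: u))%qT.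
Proof.
apply/eqP; rewrite -Quotient.idealrBE -scalerBr.
have : repr (\pi_Q u)%qT - u \in submod_pred M.
  by rewrite Quotient.idealrBE reprK.
exact: (@rpredZ _ _ M a).
Qed.

Lemma quot_scaleA a b (x : Q) :
  quot_scale a (quot_scale b x) = quot_scale (a * b) x.
Proof. by rewrite -[x]reprK (pi_quot_scale b) !pi_quot_scale scalerA. Qed.

Lemma quot_scale1 : left_id 1 quot_scale.
Proof. by move=> x; rewrite -[x]reprK pi_quot_scale scale1r. Qed.

Lemma quot_scaleDr : right_distributive quot_scale +%R.
Proof.
move=> a x y; rewrite -[x]reprK -[y]reprK !pi_quot_scale.
by rewrite -!(raddfD \pi_Q%qT) pi_quot_scale scalerDr.
Qed.

Lemma quot_scaleDl (x : Q) : {morph quot_scale^~ x : a b / a + b}.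
Proof.
by move=> a b; rewrite -[x]reprK !pi_quot_scale scalerDl raddfD.
Qed.

HB.instance Definition _ := GRing.Zmodule_isLmodule.Build K Q
  quot_scaleA quot_scale1 quot_scaleDr quot_scaleDl.

End QuotientModule.

Definition quotient_tau (K : pzRingType) (G : lmodType K) (tau : Topological G)
    (M : submodClosed G) : Topological (quot_mod M) :=
  Topological.class
    (quotient_topology (quot_mod M : quotType (topo tau))).

Definition s_module (R : realType) (G : lmodType (Ctilde R))
    (tau : Topological G) : Prop :=
  [/\ linear_topology tau, hausdorff_space (topo tau) &
      forall M : submodClosed G, @closed (topo tau) [set` M] ->
        infra_s (quotient_tau tau M)].

Definition kernel (K : pzRingType) (G F : lmodType K) (T : {linear G -> F}) :
  set G := T @^-1` [set 0].

Definition weakly_singular (R : realType) (G F : lmodType (Ctilde R))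
    (tau1 : Topological G) (tau2 : Topological F) (T : {linear G -> F}) : Prop :=
  \bigcap_(V in @nbhs _ (topo tau2) (0 : F)) @closure (topo tau1) (T @^-1` V) =
  @closure (topo tau1) (kernel T).

(* Main.v *)
Require Import Defs.
From HB Require Import structures.
From mathcomp Require Import all_boot all_order all_algebra.
From mathcomp Require Import complex.
From mathcomp Require Import all_classical all_reals all_analysis.
From mathcomp Require Import lra.

Set Implicit Arguments.
Unset Strict Implicit.
Unset Printing Implicit Defensive.

Import Order.TTheory GRing.Theory Num.Theory.
Local Open Scope classical_set_scope.
Local Open Scope ring_scope.

(** Why a weakly singular surjection T from G onto F is open.

Let N be the closure of Ker T, H = G/N with its quotient topology tau0, and p
the projection of G onto H. Since Ker T lies in N, p factors as S \o T with
S : F -> H linear and onto ([factor_linear]). Give H also the final topology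
sigma of tau2 along S; it is barrelled because barrelledness passes to final
topologies along linear surjections ([final_barrelled]).

Let tau be the infimum of tau0 and sigma among the linear topologies on H. A
point of H outside p W + S V, for W and V neighborhoods of 0 in G and F, is
separated from 0 by tau, and such W and V exist for every nonzero p u: u then
lies outside N, and weak singularity says that N is the intersection of the
closures of the sets T^-1 V. So tau is Hausdorff, and it is coarser than tau0.
As H is an infra-s module, tau0 is coarser than the associated barrelled
topology of tau, which is coarser than the barrelled topology sigma, since tau
is. Hence the identity from (H, sigma) to (H, tau0) is continuous: for every
neighborhood W of 0 in G, S^-1 (p W) is a neighborhood of 0 in F. Finally
S^-1 (p W) is contained in T (W + W), because each element of N is the sum of
an element of Ker T and one of W.

Two infima of linear topologies occur here: tau, and the associated barrelled
topology of tau, whose existence has to be proved and which is the infimum of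
all barrelled topologies finer than tau ([associated_barrelled_inf]). Both come
from one construction, [inf_topology]: its neighborhoods of 0 are the sets
containing the first knot of a string all of whose knots are neighborhoods of 0
in every topology of the family. It is the infimum because a neighborhood of 0
in a linear topology contains the first knot of a topological string
([linear_topological_string]). It inherits barrelledness because a string
closed in the infimum is closed, hence topological, in each member
([barrelled_inf]). *)

(** * The sharp norm is submultiplicative *)

Section SharpRing.
Context {R : realType}.
Implicit Types (c d : Ctilde R) (a b : R).

Lemma eps_powD a b : eps_pow (a + b) = eps_pow a * eps_pow b.
Proof.
rewrite /eps_pow -(rmorphM \pi_(Ctilde R)%qT); congr (\pi_(Ctilde R)%qT _).
apply/val_inj; rewrite [RHS](rmorphM (val : Defs.EM R -> net R)).
apply/funext => e; have /andP[e0 _] := svalP e.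
have e1 : (a + b == 0) ==> (sval e != 0) by rewrite (gt_eqF e0) implybT.
rewrite [LHS]/((sval e `^ (a + b))%:C%C) (powRD e1).
exact: (rmorphM (real_complex R)).
Qed.

Lemma eps_pow0 : eps_pow 0 = 1 :> Ctilde R.
Proof.
rewrite /eps_pow -(rmorph1 \pi_(Ctilde R)%qT); congr (\pi_(Ctilde R)%qT _).
apply/val_inj; rewrite [RHS](rmorph1 (val : Defs.EM R -> net R)).
by apply/funext => e /=; rewrite powRr0.
Qed.

Lemma eps_powNK b : eps_pow (- b) * eps_pow b = 1 :> Ctilde R.
Proof. by rewrite -eps_powD addNr eps_pow0. Qed.

Lemma eps_powKN b : eps_pow b * eps_pow (- b) = 1 :> Ctilde R.
Proof. by rewrite -eps_powD addrN eps_pow0. Qed.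

Lemma valuation_eps_pow b : (b%:E <= valuation (eps_pow b : Ctilde R))%E.
Proof.
rewrite valuation_pi; apply: ereal_sup_ubound; exists b => //.
exact: bigO_pow_powR.
Qed.

Lemma norm_e_eps_pow b : norm_e (eps_pow b : Ctilde R) <= expR (- b).
Proof.
rewrite -lee_fin norm_eE -[(expR _)%:E]/(expeR (- b%:E)).
by rewrite lee_expeR leeN2 valuation_eps_pow.
Qed.


(** Stated at a variable: comparing the two projections at a product would unfold
the multiplication of nets. *)
Lemma val_EM (z : Defs.EM R) : (val : Defs.EM R -> net R) z = EM_net z.
Proof. by []. Qed.

Lemma EM_netM (x y : Defs.EM R) : EM_net (x * y) = EM_net x * EM_net y.
Proof. by rewrite -!val_EM (rmorphM (val : Defs.EM R -> net R)). Qed.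

Lemma valuationM_lt c d a b :
  (a%:E < valuation c)%E -> (b%:E < valuation d)%E ->
  ((a + b)%:E <= valuation (c * d)%R)%E.
Proof.
move=> /ereal_sup_gt[_ [a' ca <-] aa'] /ereal_sup_gt[_ [b' db <-] bb'].
apply: (@le_trans _ _ (a' + b')%:E).
  by rewrite lee_fin lerD // ltW // -lte_fin.
rewrite -[c]reprK -[d]reprK -(rmorphM \pi_(Ctilde R)%qT) valuation_pi.
apply: ereal_sup_ubound; exists (a' + b') => //.
by rewrite /mkset EM_netM; exact: bigO_powM.
Qed.

Lemma norm_e_lt c b : (norm_e c < expR (- b)) = (b%:E < valuation c)%E.
Proof.
rewrite -lte_fin norm_eE -[(expR _)%:E]/(expeR (- b%:E)).
by rewrite lte_expeR lteN2.
Qed.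

(** Multiplying big-O bounds gives |c d| <= s t for all s > |c| and t > |d|; the
norms themselves are reached by a limit argument. *)
Lemma norm_eM c d : norm_e (c * d) <= norm_e c * norm_e d.
Proof.
have approx (s t : R) : norm_e c < s -> norm_e d < t -> norm_e (c * d) <= s * t.
  move=> cs dt; have s0 := le_lt_trans (norm_e_ge0 _) cs.
  have t0 := le_lt_trans (norm_e_ge0 _) dt.
  move: cs dt; rewrite -[s]lnK ?posrE // -[t]lnK ?posrE // -[ln s]opprK.
  rewrite -[ln t]opprK !norm_e_lt => cs dt; rewrite -expRD -opprD.
  rewrite -lee_fin norm_eE -[(expR _)%:E]/(expeR (- (- ln s - ln t)%:E)).
  by rewrite lee_expeR leeN2 valuationM_lt.
have c0 := norm_e_ge0 c; have d0 := norm_e_ge0 d.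
rewrite leNgt; apply/negP => lt_cd.
(* the bounds s = |c| + e and t = |d| + e give st < |cd| for this e *)
pose x := norm_e (c * d) - norm_e c * norm_e d.
pose e := Num.min 1 (x / (norm_e c + norm_e d + 1) / 2).
have k0 : 0 < norm_e c + norm_e d + 1 by lra.
have x0 : 0 < x by rewrite subr_gt0.
have e0 : 0 < e by rewrite lt_min ltr01 !divr_gt0.
have e1 : e <= 1 by rewrite ge_min lexx.
have : e * (norm_e c + norm_e d + 1) <= x / 2.
  by rewrite -ler_pdivlMr // mulrAC ge_min lexx orbT.
have := approx (norm_e c + e) (norm_e d + e).
rewrite !ltrDl e0 => /(_ isT isT).
rewrite /x in x0 *; nra.
Qed.

Lemma norm_e_eps_powM b c r : norm_e c <= r ->
  norm_e (eps_pow b * c) <= expR (- b) * r.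
Proof.
move=> cr; apply: le_trans (norm_eM _ _) _.
by rewrite ler_pM ?norm_e_ge0 ?norm_e_eps_pow.
Qed.

Lemma norm_e1 : norm_e (1 : Ctilde R) <= 1.
Proof. by rewrite -eps_pow0 (le_trans (norm_e_eps_pow _)) // oppr0 expR0. Qed.
End SharpRing.

(** * Linear topologies and their neighborhoods of zero *)

(** The topology is an explicit argument because several topologies on one module
are compared. *)
Definition tnbhs (T : Type) (tau : Topological T) (x : T) : set_system T :=
  @nbhs _ (topo tau) x.

Section LinearTopologies.
Context {R : realType} {G : lmodType (Ctilde R)}.
Implicit Types (tau sigma : Topological G) (A B W : set G) (x y u v : G).

Lemma tnbhsS tau x A B : A `<=` B -> tnbhs tau x A -> tnbhs tau x B.
Proof. exact: (@filterS _ _ (nbhs_filter (x : topo tau))). Qed.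

Lemma tnbhsI tau x A B :
  tnbhs tau x A -> tnbhs tau x B -> tnbhs tau x (A `&` B).
Proof. exact: (@filterI _ _ (nbhs_filter (x : topo tau))). Qed.

Lemma tnbhs_singleton tau x A : tnbhs tau x A -> A x.
Proof. exact: (@nbhs_singleton (topo tau)). Qed.

Lemma open_tnbhs tau A : @open (topo tau) A <-> (forall x, A x -> tnbhs tau x A).
Proof. by rewrite openE. Qed.

Lemma coarser_tnbhs tau sigma x : coarser tau sigma ->
  tnbhs tau x `<=` tnbhs sigma x.
Proof.
move=> ts W; rewrite /tnbhs !nbhsE => -[B [oB Bx] BW]; exists B => //.
by split=> //; exact: ts.
Qed.

Lemma linear_topologyP tau : linear_topology tau <->
  (forall x y W, tnbhs tau (x + y) W -> exists A B,
    [/\ tnbhs tau x A, tnbhs tau y B & forall u v, A u -> B v -> W (u + v)]) /\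
  (forall (l : Ctilde R) x W, tnbhs tau (l *: x) W -> exists (d : R) A,
    [/\ 0 < d, tnbhs tau x A &
        forall m u, norm_e (l - m) < d -> A u -> W (m *: u)]).
Proof.
split=> [[cD cZ]|[cD cZ]]; split.
- move=> x y W /(cD (x, y))[[A B] [/= nA nB] AB].
  by exists A, B; split=> // u v Au Bv; exact: (AB (u, v)).
- move=> l x W /(cZ (l, x))[[A B] [/= [d /= d0 dA] nB] AB].
  by exists d, B; split=> // m u lm Bu; apply: (AB (m, u)); split=> //; exact: dA.
- move=> -[x y] W /(cD x y)[A [B [nA nB AB]]].
  by exists (A, B) => // -[u v] [/= Au Bv]; exact: AB.
- move=> -[l x] W /(cZ l x)[d [A [d0 nA AB]]].
  exists (Ctilde_ball l d, A) => /=; last by move=> -[m u] [/= mu Au]; exact: AB.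
  by split=> //; exists d.
Qed.

Section OneTopology.
Context (tau : Topological G) (tau_lin : linear_topology tau).

Lemma tnbhs_addl x y W : tnbhs tau (x + y) W -> tnbhs tau y [set u | W (x + u)].
Proof.
have [+ _] := (linear_topologyP tau).1 tau_lin => /[apply] -[A [B [nA nB AB]]].
by apply: tnbhsS nB => v Bv; apply: AB => //; exact: tnbhs_singleton nA.
Qed.

Lemma tnbhs_translate x W : tnbhs tau x W <-> tnbhs tau 0 [set u | W (x + u)].
Proof.
split=> [|nW]; first by rewrite -[in tnbhs tau x](addr0 x); exact: tnbhs_addl.
rewrite (_ : W = [set u | W (x + (- x + u))]); last first.
  by apply/funext => u; rewrite /mkset addrA addrN add0r.
by apply: (tnbhs_addl (W := [set u | W (x + u)])); rewrite addNr.
Qed.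

Lemma tnbhs_scale l x W :
  tnbhs tau (l *: x) W -> tnbhs tau x [set u | W (l *: u)].
Proof.
have [_ +] := (linear_topologyP tau).1 tau_lin => /[apply] -[d [A [d0 nA AB]]].
by apply: tnbhsS nA => v Av; apply: AB; rewrite // subrr norm_e0.
Qed.

Lemma tnbhs0_scale l W : tnbhs tau 0 W -> tnbhs tau 0 [set u | W (l *: u)].
Proof. by move=> nW; apply: tnbhs_scale; rewrite scaler0. Qed.

Lemma tnbhs0_add W : tnbhs tau 0 W ->
  exists2 A, tnbhs tau 0 A & forall u v, A u -> A v -> W (u + v).
Proof.
rewrite -[in tnbhs tau 0 W](addr0 (0 : G)).
have [+ _] := (linear_topologyP tau).1 tau_lin => /[apply] -[A [B [nA nB AB]]].
by exists (A `&` B); [exact: tnbhsI|move=> u v [Au _] [_ Bv]; exact: AB].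
Qed.

(** Continuity of the scalar multiplication at (0, u): the scalars
eps ^ - b with b far below 0 are small in the sharp norm. *)
Lemma tnbhs0_absorbent W : tnbhs tau 0 W -> absorbent W.
Proof.
move=> nW u; rewrite -(scale0r u) in nW.
have [_ /(_ _ _ _ nW)[d [A [d0 nA AB]]]] :=
  (linear_topologyP tau).1 tau_lin.
(* any exponent below ln d makes |eps ^ - b| < d *)
exists (ln d - 1) => b bd; exists (eps_pow (- b) *: u).
  apply: AB; last exact: tnbhs_singleton nA.
  rewrite sub0r norm_eN (le_lt_trans (norm_e_eps_pow _)) // opprK.
  by rewrite -[ltRHS]lnK ?posrE // ltr_expR (le_lt_trans bd) // ltrBlDr ltrDl.
by rewrite scalerA eps_powKN scale1r.
Qed.

(** If l u is in W for |l| < d and u in A, and eps ^ b has norm less than d, then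
the balanced hull of (eps ^ b) A lies in W; it is a neighborhood of 0 because
eps ^ b is invertible. *)
Lemma tnbhs0_balanced W : tnbhs tau 0 W ->
  exists B, [/\ tnbhs tau 0 B, balanced B & B `<=` W].
Proof.
rewrite -[in tnbhs tau 0 W](scale0r (0 : G)).
have [_ cZ] := (linear_topologyP tau).1 tau_lin.
move=> /cZ[d [A [d0 nA AB]]] {cZ}; pose b := 1 - ln d.
exists [set l *: (eps_pow b *: u) | l in [set l | norm_e l <= 1] & u in A]; split.
- apply: tnbhsS (tnbhs0_scale (eps_pow (- b)) nA) => u Au.
  exists 1; first exact: norm_e1; exists (eps_pow (- b) *: u) => //.
  by rewrite scale1r scalerA eps_powKN scale1r.
- move=> l l1 _ [_ [m m1 [u Au <-]] <-]; exists (l * m).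
    rewrite /mkset (le_trans (norm_eM _ _)) // -[leRHS]mulr1.
    by rewrite ler_pM ?norm_e_ge0.
  by exists u; rewrite // !scalerA.
- move=> _ [l l1 [u Au <-]]; rewrite scalerA; apply: AB => //.
  rewrite sub0r norm_eN mulrC (le_lt_trans (norm_e_eps_powM _ l1)) // mulr1.
  by rewrite -[ltRHS]lnK ?posrE // ltr_expR opprB ltrBlDr ltrDl.
Qed.

Lemma hausdorff_linear :
  (forall x, x != 0 -> exists2 W, tnbhs tau 0 W & ~ W x) ->
  hausdorff_space (topo tau).
Proof.
move=> sep p q pq; apply: contrapT => /eqP neq_pq.
have : (q : G) - p != 0.
  by apply/eqP => /subr0_eq /esym qp; move: neq_pq; rewrite (qp : p = q) eqxx.
move=> /sep[W /tnbhs0_add[A nA AA]] []; move: W AA => W AA.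
have nA' := tnbhs0_scale (-1) nA.
have np : tnbhs tau p [set u | A (- p + u)].
  by apply: tnbhs_addl; rewrite addNr.
have nq : tnbhs tau q [set u | A (- 1 *: (- q + u))].
  by apply: (tnbhs_addl (W := [set u | A (- 1 *: u)])); rewrite addNr.
have [u [/= Au Au']] := pq _ _ np nq.
rewrite (_ : _ - _ = (- (p : G) + u) + (-1 *: (- (q : G) + u))); first exact: AA.
by rewrite scaleN1r opprD opprK addrACA subrr addr0 addrC.
Qed.

End OneTopology.

Lemma coarser_linear tau sigma : linear_topology tau -> linear_topology sigma ->
  tnbhs tau 0 `<=` tnbhs sigma 0 -> coarser tau sigma.
Proof.
move=> tl sl ts A /open_tnbhs oA; apply/open_tnbhs => x /oA.
by move=> /(tnbhs_translate tl x A).1 /ts /(tnbhs_translate sl x A).2.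
Qed.

End LinearTopologies.

(** * Strings *)

Section Strings.
Context {R : realType} {G : lmodType (Ctilde R)}.
Implicit Types (A B : set G) (U V : nat -> set G) (tau : Topological G).

(** Absorbency without images: eps ^ b is invertible with inverse eps ^ - b. *)
Lemma absorbentP A : absorbent A <-> forall u, exists a : R,
  forall b, b <= a -> A (eps_pow (- b) *: u).
Proof.
split=> aA u; have [a Aa] := aA u; exists a => b /Aa.
  by move=> [v Av <-]; rewrite scalerA eps_powNK scale1r.
by exists (eps_pow (- b) *: u); rewrite // scalerA eps_powKN scale1r.
Qed.

Lemma balanced_scale A l u : balanced A -> norm_e l <= 1 -> A u -> A (l *: u).
Proof. by move=> bA l1 Au; apply: bA l1 _ _; exists u. Qed.

Lemma absorbent0 A : absorbent A -> A 0.
Proof. by move=> /absorbentP/(_ 0)[a /(_ a (lexx a))]; rewrite scaler0. Qed.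

Lemma absorbentS A B : A `<=` B -> absorbent A -> absorbent B.
Proof.
move=> AB aA u; have [a Aa] := aA u; exists a => b /Aa[v Av <-].
by exists v => //; exact: AB.
Qed.

Lemma absorbentI A B : absorbent A -> absorbent B -> absorbent (A `&` B).
Proof.
move=> /absorbentP aA /absorbentP aB; apply/absorbentP => u.
have [a Aa] := aA u; have [b Bb] := aB u; exists (Num.min a b) => c.
by rewrite le_min => /andP[/Aa ? /Bb ?].
Qed.

Lemma balancedI A B : balanced A -> balanced B -> balanced (A `&` B).
Proof.
by move=> bA bB l l1 _ [u [Au Bu] <-]; split;
  [exact: balanced_scale Au|exact: balanced_scale Bu].
Qed.

Lemma stringT : string (fun=> [set: G]).
Proof. by split=> // n _; split=> //; apply/absorbentP => u; exists 0. Qed.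

Lemma stringI U V : string U -> string V -> string (fun n => U n `&` V n).
Proof.
move=> [Uba UD UZ] [Vba VD VZ]; split.
- move=> n n1; have [Ub Ua] := Uba n n1; have [Vb Va] := Vba n n1.
  by split; [exact: balancedI|exact: absorbentI].
- move=> n n1 _ [u [Uu Vu] [v [Uv Vv] <-]].
  by split; [apply: UD|apply: VD] => //; exists u => //; exists v.
- move=> n p n1 p1 _ [u [Uu Vu] <-].
  by split; [apply: UZ n1 p1 _ _|apply: VZ n1 p1 _ _]; exists u.
Qed.

Lemma stringD U V : string U -> string V ->
  string (fun n => [set u + v | u in U n & v in V n]).
Proof.
move=> [Uba UD UZ] [Vba VD VZ]; split.
- move=> n n1; have [Ub Ua] := Uba n n1; have [Vb Va] := Vba n n1; split.
    move=> l l1 _ [_ [u Uu [v Vv <-]] <-]; exists (l *: u).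
      exact: balanced_scale Uu.
    by exists (l *: v); [exact: balanced_scale Vv|rewrite scalerDr].
  apply: absorbentS Ua => u Uu; exists u => //.
  by exists 0; [exact: absorbent0|rewrite addr0].
- move=> n n1 _ [_ [u Uu [v Vv <-]] [_ [u' Uu' [v' Vv' <-]] <-]].
  exists (u + u'); first by apply: UD => //; exists u => //; exists u'.
  exists (v + v'); last by rewrite addrACA.
  by apply: VD => //; exists v => //; exists v'.
- move=> n p n1 p1 _ [_ [u Uu [v Vv <-]] <-]; rewrite scalerDr.
  exists (eps_pow (- n%:R) *: u); first by apply: UZ n1 p1 _ _; exists u.
  by exists (eps_pow (- n%:R) *: v) => //; apply: VZ n1 p1 _ _; exists v.
Qed.

Lemma string_shift U n : string U -> string (fun k => U (n + k)%N).
Proof.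
move=> [Uba UD UZ]; split=> [k k1|k k1|k p k1 p1].
- by apply: Uba; rewrite addn_gt0 k1 orbT.
- by rewrite addnS; apply: UD; rewrite addn_gt0 k1 orbT.
- by rewrite addnCA; apply: UZ => //; rewrite addn_gt0 p1 orbT.
Qed.

(** A scalar of norm at most e ^ n is eps ^ - n times one of norm at most 1, so
the scaling condition of a string controls multiplication by every scalar. *)
Lemma string_scale U n p l u : string U -> (0 < n)%N -> (0 < p)%N ->
  norm_e l <= expR n%:R -> U (n + p)%N u -> U p (l *: u).
Proof.
move=> [Uba _ UZ] n1 p1 ln Uu.
have -> : l *: u = (eps_pow n%:R * l) *: (eps_pow (- n%:R) *: u).
  by rewrite scalerA mulrAC eps_powKN mul1r.
apply: balanced_scale; first by case: (Uba p p1).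
  by rewrite (le_trans (norm_e_eps_powM _ ln)) // -expRD addNr expR0.
by apply: UZ n1 p1 _ _; exists u.
Qed.

(** Each knot is a balanced neighborhood chosen inside the previous one by
continuity of the sum and of the multiplication by eps ^ - 1; iterating the
latter gives the scaling condition for eps ^ - n. *)
Lemma linear_topological_string tau A : linear_topology tau -> tnbhs tau 0 A ->
  exists2 U, topological_string tau U & U 1 `<=` A.
Proof.
move=> tlin nA.
have next B : exists C, tnbhs tau 0 B -> [/\ tnbhs tau 0 C, balanced C,
    forall u v, C u -> C v -> B (u + v) &
    forall u, C u -> B (eps_pow (- 1) *: u)].
  have [nB|] := pselect (tnbhs tau 0 B); last by exists B.
  have [C nC CC] := tnbhs0_add tlin nB.
  have nC' := tnbhs0_scale tlin (eps_pow (- 1)) nB.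
  have [D [nD bD DC]] := tnbhs0_balanced tlin (tnbhsI nC nC').
  exists D; split=> // [u v|u] /DC[Cu Bu] //.
  by move=> /DC[Cv _]; exact: CC.
have {next}[f fP] := choice next; pose U n := iter n f A.
have nU n : tnbhs tau 0 (U n) by elim: n => // n /fP[].
have DU n u v : U n.+1 u -> U n.+1 v -> U n (u + v).
  by have [_ _ + _] := fP _ (nU n); exact.
have ZU n u : U n.+1 u -> U n (eps_pow (- 1) *: u).
  by have [_ _ _] := fP _ (nU n); exact.
exists U.
  split; last by move=> n _; exact: nU.
  split=> [[//|n] _|n _ _ [u Uu [v Uv <-]]|n p _ _].
  - by split; [case: (fP _ (nU n))|exact: tnbhs0_absorbent (nU _)].
  - exact: DU.
  - elim: n => [|n IHn] _ [u Uu <-].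
      by rewrite oppr0 eps_pow0 scale1r.
    rewrite -addn1 natrD opprD eps_powD -scalerA.
    by apply: IHn; exists (eps_pow (- 1) *: u) => //; exact: ZU.
move=> u U1u; rewrite -[u]addr0; apply: DU U1u _.
exact: tnbhs_singleton (nU 1%N).
Qed.

End Strings.

(** * Infima of linear topologies *)

Section Infimum.
Context {R : realType} {G : lmodType (Ctilde R)}.
Implicit Types (Sigma : Topological G -> Prop) (tau sigma : Topological G).

(** A family of topologies is a predicate rather than an element of [set], for
which the type of all topologies on G lies in too large a universe. *)
Definition common_string Sigma (U : nat -> set G) :=
  string U /\ forall sigma, Sigma sigma ->
    forall n, (1 <= n)%N -> tnbhs sigma 0 (U n).

(** A tail of a string is again a string, so every knot of a common string, and
not only the first, is a neighborhood of 0 for the infimum. *)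
Lemma common_string_shift Sigma U n :
  common_string Sigma U -> common_string Sigma (fun k => U (n + k)%N).
Proof.
move=> [sU nU]; split; first exact: string_shift.
by move=> sigma Ss k k1; apply: nU => //; rewrite addn_gt0 k1 orbT.
Qed.

Definition inf_space (Sigma : Topological G -> Prop) : Type := G.

Section InfSpace.
Context (Sigma : Topological G -> Prop).

HB.instance Definition _ := Choice.on (inf_space Sigma).

Definition inf_nbhs (x : inf_space Sigma) : set_system (inf_space Sigma) :=
  [set A | exists2 U, common_string Sigma U &
     forall u, U 1%N u -> A ((x : G) + u)].

HB.instance Definition _ := hasNbhs.Build (inf_space Sigma) inf_nbhs.

Let inf_nbhs_singleton (x : inf_space Sigma) A : nbhs x A -> A x.
Proof.
move=> [U [[Uba _ _] _] UA]; rewrite -[x](addr0 (x : G)); apply: UA.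
by apply: absorbent0; case: (Uba 1%N).
Qed.

Let inf_nbhs_filter (x : inf_space Sigma) : ProperFilter (nbhs x).
Proof.
apply: Build_ProperFilter_ex => [A /inf_nbhs_singleton Ax|]; first by exists x.
split.
- exists (fun=> setT) => //; split; first exact: stringT.
  by move=> sigma _ n _; exact: (@filterT _ _ (nbhs_filter (0 : topo sigma))).
- move=> A B [U [sU nU] UA] [V [sV nV] VB]; exists (fun n => U n `&` V n).
    split; first exact: stringI.
    by move=> sigma Ss n n1; apply: tnbhsI; [exact: nU|exact: nV].
  by move=> u [/UA Au /VB Bu].
- by move=> A B AB [U cU UA]; exists U => // u /UA; exact: AB.
Qed.

Let inf_nbhs_nbhs (x : inf_space Sigma) A : nbhs x A -> nbhs x (nbhs^~ A).
Proof.
move=> [U cU UA]; have cV := common_string_shift 1 cU.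
exists (fun k => U (1 + k)%N) => // u Uu.
exists (fun k => U (1 + k)%N) => // v Uv.
rewrite -addrA; apply: UA; have [[_ UD _] _] := cU.
by apply: UD => //; exists u => //; exists v.
Qed.

HB.instance Definition _ := Nbhs_isNbhsTopological.Build (inf_space Sigma)
  inf_nbhs_filter inf_nbhs_singleton inf_nbhs_nbhs.

End InfSpace.

Definition inf_topology Sigma : Topological G :=
  Topological.class (inf_space Sigma).

Lemma inf_tnbhs Sigma x A : tnbhs (inf_topology Sigma) x A <->
  exists2 U, common_string Sigma U & forall u, U 1%N u -> A (x + u).
Proof. by []. Qed.

Lemma common_string_tnbhs Sigma U n : common_string Sigma U -> (1 <= n)%N ->
  tnbhs (inf_topology Sigma) 0 (U n).
Proof.
case: n => // n cU _; apply/inf_tnbhs; exists (fun k => U (n + k)%N).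
  exact: common_string_shift.
by move=> u; rewrite addn1 add0r.
Qed.

(** The infimum is linear whatever the family: this rests only on the axioms of
strings. Near (l, x), the product m (x + u) is
l x + l u + (m - l) u + (m - l) x; the second and third terms are small by
[string_scale], the last one by absorbency. *)
Lemma inf_linear Sigma : linear_topology (inf_topology Sigma).
Proof.
apply/linear_topologyP; split=> [x y W|l x W] /inf_tnbhs[U cU UW];
    have [sU _] := cU; have [Uba UD _] := sU.
  have nU z : tnbhs (inf_topology Sigma) z [set z + u | u in U 2%N].
    apply/inf_tnbhs; exists (fun k => U (1 + k)%N).
      exact: common_string_shift.
    by move=> u Uu; exists u.
  exists [set x + u | u in U 2%N], [set y + u | u in U 2%N].
  split=> // _ _ [u Uu <-] [v Uv <-]; rewrite addrACA; apply: UW.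
  by apply: UD => //; exists u => //; exists v.
pose n := (Num.bound (norm_e l)).+1.
have ln : norm_e l <= expR n%:R.
  apply: (@le_trans _ _ n%:R).
    by rewrite ltW // (lt_trans (archi_boundP (norm_e_ge0 _))) // ltr_nat.
  by rewrite (le_trans _ (expR_ge1Dx _)) // lerDr.
have /absorbentP/(_ x)[a /(_ a (lexx a)) Ux] : absorbent (U 3).
  by case: (Uba 3%N).
have U0 k : (0 < k)%N -> U k 0 by move=> k0; apply: absorbent0; case: (Uba k).
have U32 : U 3 `<=` U 2.
  move=> u Uu; apply: UD => //; exists u => //.
  by exists 0; rewrite ?addr0 //; exact: U0.
(* knot n + 3, as l u has to land in knot 3 and |l| <= e ^ n; |m - l| < 1 is
   for (m - l) u and |m - l| < e ^ a for (m - l) x *)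
exists (Num.min 1 (expR a)), [set x + u | u in U (n + 3)%N]; split.
- by rewrite lt_min ltr01 expR_gt0.
- apply/inf_tnbhs; exists (fun k => U (n + 2 + k)%N).
    exact: common_string_shift.
  by move=> u Uu; exists u => //; rewrite -[3%N]/(2 + 1)%N addnA.
move=> m _ lm [u Uu <-]; rewrite scalerDr.
have : norm_e (m - l) < Num.min 1 (expR a) by rewrite -norm_eN opprB.
rewrite lt_min => /andP[ml1 mla].
have -> : m *: x + m *: u = l *: x + (l *: u + ((m - l) *: u + (m - l) *: x)).
  by rewrite [RHS]addrA -!scalerDr [u + x]addrC -scalerDl [l + _]addrC subrK.
have n0 : (0 < n)%N by [].
apply: UW; apply: (UD) => //; exists (l *: u).
  by apply: U32; exact: string_scale sU n0 _ ln Uu.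
exists ((m - l) *: u + (m - l) *: x) => //; apply: UD => //.
exists ((m - l) *: u).
  apply: string_scale sU n0 _ _ Uu => //.
  by rewrite (le_trans (ltW ml1)) // -[leLHS]expR0 ler_expR ler0n.
exists ((m - l) *: x) => //.
have -> : (m - l) *: x = (eps_pow a * (m - l)) *: (eps_pow (- a) *: x).
  by rewrite scalerA mulrAC eps_powKN mul1r.
apply: balanced_scale Ux; first by case: (Uba 3%N).
by rewrite (le_trans (norm_e_eps_powM _ (ltW mla))) // -expRD addNr expR0.
Qed.

Lemma coarser_inf Sigma sigma : linear_topology sigma -> Sigma sigma ->
  coarser (inf_topology Sigma) sigma.
Proof.
move=> sl Ss; apply: coarser_linear (inf_linear _) (sl) _.
move=> A /inf_tnbhs[U [_ nU] UA]; apply: tnbhsS (nU _ Ss 1%N _) => // u /UA.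
by rewrite add0r.
Qed.

Lemma inf_greatest Sigma tau : linear_topology tau ->
  (forall sigma, Sigma sigma -> coarser tau sigma) ->
  coarser tau (inf_topology Sigma).
Proof.
move=> tl tS; apply: coarser_linear (tl) (inf_linear _) _ => A nA.
have [U [sU nU] UA] := linear_topological_string tl nA.
apply/inf_tnbhs; exists U; last by move=> u /UA; rewrite add0r.
by split=> // sigma /tS ts n /nU; exact: coarser_tnbhs.
Qed.

Lemma coarser_closed tau sigma A : coarser tau sigma ->
  @closed (topo tau) A -> @closed (topo sigma) A.
Proof. by move=> ts; rewrite -!openC; exact: ts. Qed.

(** A closed string of the infimum is closed, hence topological, for each member,
and so it is itself one of the strings that define the infimum. *)
Lemma barrelled_inf Sigma : (forall sigma, Sigma sigma -> barrelled sigma) ->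
  barrelled (inf_topology Sigma).
Proof.
move=> Sb; split=> [|U [sU cU]]; first exact: inf_linear.
split=> // n n1; apply: common_string_tnbhs n1; split=> // sigma Ss k k1.
have [sl sb] := Sb _ Ss.
have [] // : topological_string sigma U; last by move=> _; exact.
apply: sb; split=> // p /cU; exact: coarser_closed (coarser_inf sl Ss).
Qed.

Lemma associated_barrelled_inf tau : linear_topology tau ->
  associated_barrelled tau
    (inf_topology (fun sigma => barrelled sigma /\ coarser tau sigma)).
Proof.
move=> tl; split; first by apply: barrelled_inf => sigma [].
  by apply: inf_greatest => // sigma [].
by move=> sigma sb ts; apply: coarser_inf; [case: sb|].
Qed.

End Infimum.

(** * Final topologies along linear surjections *)

Section FinalTopology.
Context {X Y : choiceType} (f : X -> Y) (tau : Topological X).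

Definition final_space : Type := Y.

HB.instance Definition _ := Choice.on final_space.

Definition final_open : set_system final_space :=
  [set A | @open (topo tau) (f @^-1` A)].

Let final_openT : final_open setT.
Proof. by rewrite /final_open /mkset preimage_setT; exact: openT. Qed.

Let final_openI : setI_closed final_open.
Proof. by move=> A B; exact: openI. Qed.

Let final_open_bigU (I : Type) (B : I -> set final_space) :
  (forall i, final_open (B i)) -> final_open (\bigcup_i B i).
Proof. by move=> oB; apply: bigcup_open => i _; exact: oB. Qed.

HB.instance Definition _ := isOpenTopological.Build final_space
  final_openT final_openI final_open_bigU.

Definition final_topology : Topological Y := Topological.class final_space.

End FinalTopology.

(** Final topologies up to their presentation: this applies both to
[final_topology] and to the quotient topology of a quotient module. *)
Definition is_final (X Y : Type) (f : X -> Y) (tau : Topological X)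
    (sigma : Topological Y) :=
  forall A, @open (topo sigma) A <-> @open (topo tau) (f @^-1` A).

Lemma final_topologyP (X Y : choiceType) (f : X -> Y) (tau : Topological X) :
  is_final f tau (final_topology f tau).
Proof. by []. Qed.

Section FinalLinear.
Context {R : realType} {F H : lmodType (Ctilde R)} (f : {linear F -> H}).
Context (tau : Topological F) (sigma : Topological H).
Context (f_surj : forall y, exists x, f x = y) (fin : is_final f tau sigma).
Context (tau_lin : linear_topology tau).

(** The preimage of f A is the union of the translates of A by elements of the
kernel of f, hence open. *)
Lemma final_open_map A : @open (topo tau) A -> @open (topo sigma) (f @` A).
Proof.
move=> oA; apply/fin; apply/open_tnbhs => x [a Aa fax].
have nA : tnbhs tau x [set u | A (a - x + u)].
  by apply: tnbhs_addl => //; rewrite subrK; exact: (open_tnbhs tau A).1.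
apply: tnbhsS nA => u Au; exists (a - x + u) => //.
by rewrite linearD linearB fax subrr add0r.
Qed.

Lemma final_tnbhs x W : tnbhs sigma (f x) W <-> tnbhs tau x (f @^-1` W).
Proof.
rewrite /tnbhs !nbhsE; split=> -[B [oB Bx] BW].
  by exists (f @^-1` B); [split=> //; exact/fin|move=> u /BW].
exists (f @` B); last by move=> _ [u /BW Wu <-].
by split; [exact: final_open_map|exists x].
Qed.

Lemma final_linear : linear_topology sigma.
Proof.
have [tD tZ] := (linear_topologyP tau).1 tau_lin.
apply/linear_topologyP; split.
- move=> x y W; have [u <-] := f_surj x; have [v <-] := f_surj y.
  rewrite -linearD => /final_tnbhs/tD[A [B [nA nB AB]]].
  exists (f @` A), (f @` B); split.
  + by apply/final_tnbhs; apply: tnbhsS nA => a Aa; exists a.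
  + by apply/final_tnbhs; apply: tnbhsS nB => a Aa; exists a.
  + by move=> _ _ [a Aa <-] [b Bb <-]; rewrite -linearD; exact: AB.
- move=> l x W; have [u <-] := f_surj x.
  rewrite -linearZ => /final_tnbhs/tZ[d [A [d0 nA AB]]].
  exists d, (f @` A); split=> //.
    by apply/final_tnbhs; apply: tnbhsS nA => a Aa; exists a.
  by move=> m _ lm [a Aa <-]; rewrite -linearZ; exact: AB.
Qed.

End FinalLinear.

Section StringPreimage.
Context {R : realType} {F H : lmodType (Ctilde R)} (f : {linear F -> H}).

Lemma string_preimage (U : nat -> set H) :
  string U -> string (fun n => f @^-1` U n).
Proof.
move=> [Uba UD UZ]; split.
- move=> n /Uba[Ub /absorbentP Ua]; split.
    move=> l l1 _ [u Uu <-]; rewrite /preimage /= linearZ /=.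
    exact: (balanced_scale Ub l1 Uu).
  apply/absorbentP => u; have [a Aa] := Ua (f u); exists a => b /Aa.
  by rewrite /preimage /= linearZ /=.
- move=> n n1 _ [u Uu [v Uv <-]]; rewrite /preimage /= linearD.
  by apply: UD => //; exists (f u) => //; exists (f v).
- move=> n p n1 p1 _ [u Uu <-]; rewrite /preimage /= linearZ /=.
  by apply: UZ n1 p1 _ _; exists (f u).
Qed.

(** The preimage of a closed string is a closed string, hence topological, and f
is open. *)
Lemma final_barrelled (tau : Topological F) (sigma : Topological H) :
  (forall y, exists x, f x = y) -> is_final f tau sigma ->
  barrelled tau -> barrelled sigma.
Proof.
move=> f_surj fin [tl tb]; split; first exact: final_linear fin tl.
move=> U [sU cU]; split=> // n n1.
have [_ /(_ n n1) nU] : topological_string tau (fun n => f @^-1` U n).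
  apply: tb; split; first exact: string_preimage.
  by move=> k /cU; rewrite -!openC => /fin.
by rewrite -(linear0 f); apply/(final_tnbhs fin tl).
Qed.

End StringPreimage.

(** * Submodules, quotients and factorizations *)

Section Submodules.
Context {R : realType} {G : lmodType (Ctilde R)}.

Lemma closure_submod (tau : Topological G) (A : set G) :
  linear_topology tau -> A 0 -> (forall l u v, A u -> A v -> A (l *: u + v)) ->
  exists M : submodClosed G, [set` M] = @closure (topo tau) A.
Proof.
move=> tl A0 AD; pose P : {pred G} := [pred x | `[< @closure (topo tau) A x >]].
have Psub : submod_closed P.
  split; first by apply/asboolP; exact: (@subset_closure (topo tau)).
  move=> l x y /asboolP clx /asboolP cly; apply/asboolP => W nW.
  have [/(_ _ _ _ nW)[B [C [nB nC BC]]] _] := (linear_topologyP tau).1 tl.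
  have [u [Au Bu]] := clx _ (tnbhs_scale tl nB).
  have [v [Av Cv]] := cly _ nC.
  by exists (l *: u + v); split; [exact: AD|exact: BC].
pose M : submodClosed G := HB.pack P (GRing.isSubmodClosed.Build _ _ P Psub).
by exists M; apply/seteqP; split => x /asboolP.
Qed.

End Submodules.

Lemma quot_pi_is_scalable (K : pzRingType) (G : lmodType K)
  (M : submodClosed G) : scalable (\pi_(quot_mod M)%qT : G -> quot_mod M).
Proof. by move=> a u; rewrite -pi_quot_scale. Qed.

HB.instance Definition _ (K : pzRingType) (G : lmodType K)
    (M : submodClosed G) :=
  GRing.isScalable.Build _ _ _ _ (\pi_(quot_mod M)%qT : G -> quot_mod M)
    (@quot_pi_is_scalable K G M).

Lemma factor_linear (K : pzRingType) (G F H : lmodType K)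
    (T : {linear G -> F}) (p : {linear G -> H}) :
  (forall y, exists u, T u = y) -> (forall u, T u = 0 -> p u = 0) ->
  exists S : {linear F -> H}, forall u, S (T u) = p u.
Proof.
move=> Tsurj kerTp; have [s sP] := choice Tsurj.
have pE u v : T u = T v -> p u = p v.
  move=> Tuv; apply/eqP; rewrite -subr_eq0 -linearB; apply/eqP/kerTp.
  by rewrite linearB Tuv subrr.
have Slin : linear (p \o s).
  by move=> a x y; rewrite /= -linearP; apply: pE; rewrite linearP !sP.
pose S : {linear F -> H} :=
  HB.pack (p \o s) (GRing.isLinear.Build _ _ _ _ _ Slin).
by exists S => u; apply: pE; rewrite sP.
Qed.

(** * Open maps from weak singularity *)

Section ClosureSums.
Context {R : realType} {G : lmodType (Ctilde R)}.
Context (tau1 : Topological G) (tau1_lin : linear_topology tau1).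

Lemma closure_subD A W x : tnbhs tau1 0 W -> @closure (topo tau1) A x ->
  exists a w, [/\ A a, W w & x = a + w].
Proof.
move=> nW clx.
have nx : tnbhs tau1 x [set u | W (-1 *: (- x + u))].
  apply: (tnbhs_addl tau1_lin (W := [set u | W (-1 *: u)])).
  by rewrite addNr; exact: tnbhs0_scale.
have [a [Aa Wa]] := clx _ nx; exists a, (x - a).
split=> //; last by rewrite addrC subrK.
by move: Wa; rewrite /= scaleN1r opprD opprK.
Qed.

Lemma notin_closureD A x : ~ @closure (topo tau1) A x ->
  exists2 W, tnbhs tau1 0 W & forall a w, A a -> W w -> x <> a + w.
Proof.
move=> ncl; apply: contrapT => H; apply: ncl => B nB.
have nW : tnbhs tau1 0 [set u | B (x + -1 *: u)].
  apply: (tnbhs0_scale tau1_lin (-1) (W := [set u | B (x + u)])).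
  exact: (tnbhs_translate tau1_lin x B).1.
apply: contrapT => AB0; apply: H; exists [set u | B (x + -1 *: u)] => //.
move=> a w Aa Bw xaw; apply: AB0; exists a; split=> //.
by move: Bw; rewrite /= scaleN1r xaw addrK.
Qed.
End ClosureSums.

(** The theorem for an arbitrary presentation p : G -> H of the quotient of G by
the closure of Ker T. *)
Lemma weakly_singular_open
    (R : realType) (G F H : lmodType (Ctilde R)) (tau1 : Topological G)
    (tau2 : Topological F) (T : {linear G -> F})
    (p : {linear G -> H}) (tau0 : Topological H) :
  linear_topology tau1 -> barrelled tau2 ->
  (forall y, exists u, T u = y) -> weakly_singular tau1 tau2 T ->
  (forall x, exists u, p u = x) -> is_final p tau1 tau0 ->
  (forall u, p u = 0 <-> @closure (topo tau1) (Defs.kernel T) u) ->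
  infra_s tau0 ->
  forall A : set G, @open (topo tau1) A -> @open (topo tau2) (T @` A).
Proof.
move=> tl1 tb2 Tsurj ws psurj pfin pker [tl0 _ infra] A oA.
have tl2 : linear_topology tau2 by case: tb2.
have kerT0 u : T u = 0 -> p u = 0.
  by move=> Tu; apply/pker; exact: (@subset_closure (topo tau1)).
have [S ST] := factor_linear Tsurj kerT0.
have Ssurj x : exists y, S y = x by have [u <-] := psurj x; exists (T u).
pose sigma := final_topology S tau2.
have Sfin : is_final S tau2 sigma by exact: final_topologyP.
have sb : barrelled sigma := final_barrelled Ssurj Sfin tb2.
have sl : linear_topology sigma by case: sb.
(* each element of N is the sum of one of Ker T and one of W *)
have p_split W u v : tnbhs tau1 0 W -> p u = p v ->
    exists w k, [/\ W w, T k = 0 & u = v + w + k].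
  move=> nW puv; have : @closure (topo tau1) (Defs.kernel T) (u - v).
    by apply/pker; rewrite linearB puv subrr.
  move=> /(closure_subD tl1 nW)[k [w [Tk Ww uv]]]; exists w, k; split=> //.
  by rewrite -[LHS](subrK v) uv addrC [k + w]addrC addrA.
pose tau := inf_topology (fun rho => rho = tau0 \/ rho = sigma).
have tl : linear_topology tau := inf_linear _.
have tau_tau0 : coarser tau tau0 by apply: coarser_inf => //; left.
have tau_sigma : coarser tau sigma by apply: coarser_inf => //; right.
have tauH : hausdorff_space (topo tau).
  apply: hausdorff_linear => // x x0; have [u px] := psurj x.
  have : ~ @closure (topo tau1) (Defs.kernel T) u.
    by move=> /pker pu0; move: x0; rewrite -px pu0 eqxx.
  rewrite -ws => /existsNP[V /not_implyP[nV]].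
  move=> /(notin_closureD tl1)[W /(tnbhs0_add tl1)[W' nW' W'W] Wu].
  have npW : tnbhs tau0 0 (p @` W').
    rewrite -(linear0 p); apply/(final_tnbhs pfin tl1).
    by apply: tnbhsS nW' => w Ww; exists w.
  have nSV : tnbhs sigma 0 (S @` V).
    rewrite -(linear0 S); apply/(final_tnbhs Sfin tl2).
    by apply: (tnbhsS _ (nV : tnbhs tau2 0 V)) => v Vv; exists v.
  (* p W' + S V avoids p u; the sum of strings inside p W' and S V makes it a
     neighborhood for both topologies *)
  have [P [sP nP] Pp] := linear_topological_string tl0 npW.
  have [Q [sQ nQ] QS] := linear_topological_string sl nSV.
  exists [set a + b | a in P 1%N & b in Q 1%N].
    apply: (common_string_tnbhs
      (U := fun n => [set a + b | a in P n & b in Q n])) => //.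
    have [[Pba _ _] [Qba _ _]] := (sP, sQ).
    split; first exact: stringD.
    move=> rho [->|->] n n1.
      apply: tnbhsS (nP n n1) => a Pa; exists a => //; exists 0.
        by apply: absorbent0; case: (Qba n).
      by rewrite addr0.
    apply: tnbhsS (nQ n n1) => b Qb; exists 0.
      by apply: absorbent0; case: (Pba n).
    by exists b; rewrite ?add0r.
  move=> [_ /Pp[w Ww <-] [_ /QS[v Vv <-]]].
  have [g gv] := Tsurj v; rewrite -px -gv ST -linearD => /esym.
  move=> /(p_split _ _ _ nW')[w' [k [Ww' Tk ugk]]].
  apply: (Wu (g + k) (w + w')); rewrite ?ugk.
  - by rewrite /preimage /= linearD Tk addr0 gv.
  - exact: W'W.
  - by rewrite addrACA [g + w]addrC [k + _]addrC !addrA.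
have tt := associated_barrelled_inf tl.
have tau0_sigma : coarser tau0 sigma.
  move=> B oB; have [_ _] := tt; apply; [exact: sb|exact: tau_sigma|].
  exact: infra tl tauH tau_tau0 tt _ oB.
apply/open_tnbhs => _ [a Aa <-].
have /(tnbhs0_add tl1)[W nW WA] : tnbhs tau1 0 [set u | A (a + u)].
  by apply: (tnbhs_translate tl1 _ _).1; exact: (open_tnbhs tau1 A).1.
have npW : tnbhs tau0 0 (p @` W).
  rewrite -(linear0 p); apply/(final_tnbhs pfin tl1).
  by apply: tnbhsS nW => w Ww; exists w.
have : tnbhs tau2 0 (S @^-1` (p @` W)).
  apply/(final_tnbhs Sfin tl2); rewrite linear0; exact: coarser_tnbhs npW.
move=> nSW; apply: (tnbhs_translate tl2 _ _).2; apply: tnbhsS nSW => y.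
have [u <-] := Tsurj y; rewrite /preimage /= ST => -[w Ww /esym].
move=> /(p_split _ _ _ nW)[w' [k [Ww' Tk ->]]].
exists (a + (w + w')); first exact: WA.
by rewrite !linearD Tk addr0.
Qed.

Theorem theorem3p36 (R : realType) (G F : lmodType (Ctilde R))
    (tau1 : Topological G) (tau2 : Topological F) (T : {linear G -> F}) :
  s_module tau1 ->
  barrelled tau2 ->
  set_surj [set: G] [set: F] T ->
  weakly_singular tau1 tau2 T ->
  forall A : set G, @open (topo tau1) A -> @open (topo tau2) (T @` A).
Proof.
move=> [tl1 _ quot_infra] tb2 Tsurj ws.
have [M ME] : exists M : submodClosed G,
    [set` M] = @closure (topo tau1) (Defs.kernel T).
  apply: closure_submod => //; first exact: linear0.
  move=> l u v; rewrite /Defs.kernel /preimage /= linearP => -> ->.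
  by rewrite scaler0 addr0.
apply: (weakly_singular_open (p := \pi_(quot_mod M)%qT)
  (tau0 := quotient_tau tau1 M)) => //.
- by move=> y; have [u _ <-] := Tsurj y Logic.I; exists u.
- by move=> x; exists (repr x); exact: reprK.
- rewrite -ME => u /=; split=> [pu0|Mu].
    have : (u - 0) \in submod_pred M by rewrite Quotient.idealrBE raddf0 pu0.
    by rewrite subr0.
  have : (u - 0) \in submod_pred M by rewrite subr0.
  by rewrite Quotient.idealrBE raddf0 => /eqP.
- by apply: quot_infra; rewrite ME; exact: closed_closure.
Qed.
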